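(* Let $\boldsymbol{\mathscr{X}}\in\mathbb{R}^{I_1\times\cdots\times I_N}$ and let $(\boldsymbol{\mathscr{Y}}^t)_{t\ge 0}$, $\boldsymbol{\mathscr{Y}}^t=(\boldsymbol{\mathscr{G}}_1^t,\dots,\boldsymbol{\mathscr{G}}_N^t)$, be the sequence of iterates produced by the algorithm TR-BRSGD (defined in the context) with step sizes $\alpha^t>0$. Suppose that $\sum_{t=0}^{\infty}\alpha^t=\infty$ and $\sum_{t=0}^{\infty}(\alpha^t)^2<\infty$, and that the updates $\mathbf{G}_{n(2)}^t$ are bounded for all $n$ and $t$ (i.e., there is a constant $C<\infty$ with $\|\mathbf{G}_{n(2)}^t\|_F\le C$ for all $n\in\{1,\dots,N\}$ and all $t\ge 0$). Then $$\liminf_{t\to\infty}\ \mathbb{E}\left[\left\|\nabla f(\boldsymbol{\mathscr{Y}}^t)\right\|_F^2\right]=0 .$$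
   Context: Multi-index: $\overline{i_1i_2\cdots i_N}=i_1+(i_2-1)I_1+\cdots+(i_N-1)I_1\cdots I_{N-1}$. Tensor ring (TR) model: given cores $\boldsymbol{\mathscr{G}}_n\in\mathbb{R}^{R_n\times I_n\times R_{n+1}}$, $n=1,\dots,N$, with $R_{N+1}=R_1$, let $\mathbf{G}_n(i_n)=\boldsymbol{\mathscr{G}}_n(:,i_n,:)\in\mathbb{R}^{R_n\times R_{n+1}}$ (lateral slices). $\mathrm{TR}(\{\boldsymbol{\mathscr{G}}_n\}_{n=1}^N)$ is the tensor in $\mathbb{R}^{I_1\times\cdots\times I_N}$ with entries $\mathrm{Trace}(\mathbf{G}_1(i_1)\mathbf{G}_2(i_2)\cdots\mathbf{G}_N(i_N))$. Core indices are understood cyclically modulo $N$. Unfoldings: $J_n=\prod_{k\ne n}I_k$. $\mathbf{X}_{[n]}\in\mathbb{R}^{I_n\times J_n}$ has entries $\mathbf{X}_{[n]}(i_n,\overline{i_{n+1}\cdots i_Ni_1\cdots i_{n-1}})=\boldsymbol{\mathscr{X}}(i_1,\dots,i_N)$. $\mathbf{G}_{n(2)}\in\mathbb{R}^{I_n\times R_nR_{n+1}}$ has entries $\mathbf{G}_{n(2)}(i,\overline{r\,r'})=\boldsymbol{\mathscr{G}}_n(r,i,r')$. The subchain tensor $\boldsymbol{\mathscr{G}}^{\ne n}\in\mathbb{R}^{R_{n+1}\times J_n\times R_n}$ has lateral slice number $\overline{i_{n+1}\cdots i_Ni_1\cdots i_{n-1}}$ equal to $\mathbf{G}_{n+1}(i_{n+1})\cdots\mathbf{G}_N(i_N)\mathbf{G}_1(i_1)\cdots\mathbf{G}_{n-1}(i_{n-1})$,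 and $\mathbf{G}^{\ne n}_{[2]}\in\mathbb{R}^{J_n\times R_nR_{n+1}}$ has entries $\mathbf{G}^{\ne n}_{[2]}(j,\overline{r\,r'})=\boldsymbol{\mathscr{G}}^{\ne n}(r',j,r)$. Objective: for $\boldsymbol{\mathscr{Y}}=(\boldsymbol{\mathscr{G}}_1,\dots,\boldsymbol{\mathscr{G}}_N)$, $f(\boldsymbol{\mathscr{Y}})=\frac12\|\mathrm{TR}(\{\boldsymbol{\mathscr{G}}_n\})-\boldsymbol{\mathscr{X}}\|_F^2=\frac12\|\mathbf{X}_{[n]}-\mathbf{G}_{n(2)}(\mathbf{G}^{\ne n}_{[2]})^\top\|_F^2$ for each $n$, with partial gradients $\nabla_{\mathbf{G}_{n(2)}}f(\boldsymbol{\mathscr{Y}})=\mathbf{G}_{n(2)}(\mathbf{G}^{\ne n}_{[2]})^\top\mathbf{G}^{\ne n}_{[2]}-\mathbf{X}_{[n]}\mathbf{G}^{\ne n}_{[2]}$; $\nabla f$ is the collection of these blocks, so $\|\nabla f\|_F^2=\sum_{n=1}^N\|\nabla_{\mathbf{G}_{n(2)}}f\|_F^2$. Algorithm TR-BRSGD. Inputs: $\boldsymbol{\mathscr{X}}$, the TR-ranks $R_1,\dots,R_N$, sampling sizes $|\mathcal{F}_n|\ge1$, deterministic step sizes $\alpha^t>0$, and probability distributions $\boldsymbol{p}_k\in[0,1]^{I_k}$, $k=1,\dots,N$, with positive entries. Put $\boldsymbol{q}^{\ne n}(\overline{i_{n+1}\cdots i_Ni_1\cdots i_{n-1}})=\prod_{k\ne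 n}\boldsymbol{p}_k(i_k)$, a probability distribution $[p_1,\dots,p_{J_n}]^\top$ on $\{1,\dots,J_n\}$. Start from initial cores $\boldsymbol{\mathscr{Y}}^0$. At iteration $t=0,1,2,\dots$ (run indefinitely): draw a mode $n=\xi^t$ uniformly from $\{1,\dots,N\}$ independently of the past; given $n$, draw $|\mathcal{F}_n|$ indices $j_1,\dots,j_{|\mathcal{F}_n|}$ independently with replacement from $\boldsymbol{q}^{\ne n}$, independently of the past (this list is $\mathcal{F}_n$); form, with all quantities evaluated at $\boldsymbol{\mathscr{Y}}^t$, $$\mathfrak{g}_n^t=\frac{1}{|\mathcal{F}_n|}\left(\mathbf{G}_{n(2)}(\mathbf{G}^{\ne n}_{[2]}(\mathcal{F}_n,:))^\top\mathbf{D}\,\mathbf{G}^{\ne n}_{[2]}(\mathcal{F}_n,:)-\mathbf{X}_{[n]}(:,\mathcal{F}_n)\mathbf{D}\,\mathbf{G}^{\ne n}_{[2]}(\mathcal{F}_n,:)\right),\quad \mathbf{D}=\mathrm{diag}\left(\tfrac1{p_{j_1}},\dots,\tfrac1{p_{j_{|\mathcal{F}_n|}}}\right),$$ and set $\mathbf{G}_{n(2)}^{t+1}=\mathbf{G}_{n(2)}^t-\alpha^t\mathfrak{g}_n^t$ and $\mathbf{G}_{n'(2)}^{t+1}=\mathbf{G}_{n'(2)}^t$ for $n'\ne n$. $\mathbb{E}$ is the total expectation over all random draws. *)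

(* Defs.v *)
From HB Require Import structures.
From mathcomp Require Import all_boot all_order all_algebra.
From mathcomp Require Import all_classical all_reals all_analysis.

Set Implicit Arguments.
Unset Strict Implicit.
Unset Printing Implicit Defensive.

Import Order.TTheory GRing.Theory Num.Theory.
Import numFieldNormedType.Exports.

Local Open Scope ring_scope.

(* All indices are 0-based. A tensor has N.+1 >= 1 modes, indexed cyclically
   by 'I_N.+1; the successor of a mode is ordS, so the convention
   R_{N+1} = R_1 is built into the types. *)

Lemma iter_ordS (N k : nat) (n : 'I_N.+1) :
  iter k (@ordS N.+1) n = ((n + k) %% N.+1)%N :> nat.
Proof.
elim: k => [|k IHk] /=; first by rewrite addn0 modn_small.
by rewrite IHk -addn1 modnDml -addnA addn1.
Qed.

Lemma iter_ordS_cycle (N : nat) (n : 'I_N.+1) :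
  iter N.+1 (@ordS N.+1) n = n.
Proof. by apply: ord_inj; rewrite iter_ordS modnDr modn_small. Qed.

Lemma iter_ordS_next (N : nat) (n : 'I_N.+1) :
  iter N (@ordS N.+1) (ordS n) = n.
Proof. by rewrite -iterSr iter_ordS_cycle. Qed.

Definition sqfrob (R : realType) (m n : nat) (A : 'M[R]_(m, n)) : R :=
  \sum_i \sum_j A i j ^+ 2.

Section TensorRing.
Variables (R : realType) (N : nat) (I rk : 'I_N.+1 -> nat).
Hypothesis I_gt0 : forall k, (0 < I k)%N.

Definition mindex : finType := {dffun forall k : 'I_N.+1, 'I_(I k)}.

Definition tensor : Type := mindex -> R.

(* The core G_n is given by its lateral slices G_n(i) = G_n(:, i, :). *)
Definition cores : Type :=
  forall n : 'I_N.+1, 'I_(I n) -> 'M[R]_(rk n, rk (ordS n)).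

(* G_n(i_n) G_{n+1}(i_{n+1}) ... : the product of k consecutive slices. *)
Fixpoint chain (Y : cores) (x : forall k, 'I_(I k)) (n : 'I_N.+1) (k : nat) :
    'M[R]_(rk n, rk (iter k (@ordS N.+1) n)) :=
  match k with
  | 0 => 1%:M
  | k'.+1 => chain Y x n k' *m Y _ (x (iter k' (@ordS N.+1) n))
  end.

Definition TR (Y : cores) : tensor := fun x =>
  \tr (castmx (erefl, congr1 rk (iter_ordS_cycle ord0)) (chain Y x ord0 N.+1)).

Definition objective (X : tensor) (Y : cores) : R :=
  2^-1 * \sum_(x : mindex) (TR Y x - X x) ^+ 2.

Definition J (n : 'I_N.+1) : nat := (\prod_(k | k != n) I k)%N.

(* The position of mode k in the cyclic list n+1, n+2, ..., n-1, n of modes. *)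
Definition pos (n k : 'I_N.+1) : nat := ((k + (N - n)) %% N.+1)%N.

Definition stride (n k : 'I_N.+1) : nat :=
  (\prod_(l | pos n l < pos n k) I l)%N.

(* The number of (x_{n+1}, x_{n+2}, ..., x_{n-1}), first index fastest. *)
Definition overline (n : 'I_N.+1) (x : forall k, 'I_(I k)) : nat :=
  (\sum_(k | k != n) x k * stride n k)%N.

(* The inverse of overline: the mixed-radix digits of j. The digit at mode n is
   irrelevant (it is 0) and is never used below. *)
Definition digits (n : 'I_N.+1) (j : 'I_(J n)) (k : 'I_N.+1) : 'I_(I k) :=
  Ordinal (ltn_pmod (j %/ stride n k) (I_gt0 k)).

(* The multi-index x with x n = i and overline n x = j. *)
Definition multi_index (n : 'I_N.+1) (i : 'I_(I n)) (j : 'I_(J n)) : mindex :=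
  finfun (dfwith (digits j) n i).

Definition unfold_tensor (X : tensor) (n : 'I_N.+1) : 'M[R]_(I n, J n) :=
  \matrix_(i, j) X (multi_index i j).

(* G_{n(2)}: the column number r + r' R_n of (r, r') is that of the entry
   (r', r) in the row-major numbering used by mxvec, whence the transpose. *)
Definition unfold2 (n : 'I_N.+1) (G : 'I_(I n) -> 'M[R]_(rk n, rk (ordS n))) :
    'M[R]_(I n, rk (ordS n) * rk n) :=
  \matrix_(i, c) mxvec (G i)^T 0 c.

Definition fold2 (n : 'I_N.+1) (M : 'M[R]_(I n, rk (ordS n) * rk n)) :
    'I_(I n) -> 'M[R]_(rk n, rk (ordS n)) :=
  fun i => (vec_mx (row i M))^T.

Lemma unfold2K (n : 'I_N.+1) : cancel (@unfold2 n) (@fold2 n).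
Proof.
move=> G; apply/funext => i; rewrite /fold2.
by have -> : row i (unfold2 G) = mxvec (G i)^T
     by [apply/rowP => c; rewrite !mxE]; rewrite mxvecK trmxK.
Qed.

Lemma fold2K (n : 'I_N.+1) : cancel (@fold2 n) (@unfold2 n).
Proof. by move=> M; apply/matrixP => i c; rewrite mxE trmxK vec_mxK mxE. Qed.

Definition subchain (Y : cores) (n : 'I_N.+1) (j : 'I_(J n)) :
    'M[R]_(rk (ordS n), rk n) :=
  castmx (erefl, congr1 rk (iter_ordS_next n)) (chain Y (digits j) (ordS n) N).

Definition subchain2 (Y : cores) (n : 'I_N.+1) :
    'M[R]_(J n, rk (ordS n) * rk n) :=
  \matrix_(j, c) mxvec (subchain Y j) 0 c.

Definition set_core (Y : cores) (n : 'I_N.+1)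
    (M : 'M[R]_(I n, rk (ordS n) * rk n)) : cores :=
  dfwith Y n (fold2 M).

Definition gradient (X : tensor) (Y : cores) (n : 'I_N.+1) :
    'M[R]_(I n, rk (ordS n) * rk n) :=
  \matrix_(i, c)
    derive1 (fun h : R =>
      objective X (set_core Y (unfold2 (Y n) + h *: delta_mx i c))) 0.

Definition sqnorm_gradient (X : tensor) (Y : cores) : R :=
  \sum_n sqfrob (gradient X Y n).

Section Algorithm.
Variables (m : 'I_N.+1 -> nat) (p : forall k, 'I_(I k) -> R).

Definition q (n : 'I_N.+1) (j : 'I_(J n)) : R :=
  \prod_(k | k != n) p (digits j k).

(* One random draw: a mode n together with the list F_n of m n columns. *)
Definition draw : Type := {n : 'I_N.+1 & (m n).-tuple 'I_(J n)}.

Definition estimator (X : tensor) (Y : cores) (n : 'I_N.+1)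
    (F : (m n).-tuple 'I_(J n)) : 'M[R]_(I n, rk (ordS n) * rk n) :=
  let G := unfold2 (Y n) in
  let GF := rowsub (tnth F) (subchain2 Y n) in
  let XF := colsub (tnth F) (unfold_tensor X n) in
  let D := diag_mx (\row_l (q (tnth F l))^-1) in
  (m n)%:R^-1 *: (G *m GF^T *m D *m GF - XF *m D *m GF).

Definition step (X : tensor) (a : R) (Y : cores) (e : draw) : cores :=
  let n := tag e in
  set_core Y (unfold2 (Y n) - a *: estimator X Y (tagged e)).

Fixpoint iterate (X : tensor) (alpha : nat -> R) (Y0 : cores)
    (e : nat -> draw) (t : nat) : cores :=
  match t with
  | 0 => Y0
  | t'.+1 => step X (alpha t') (iterate X alpha Y0 e t') (e t')
  end.

Section Sampling.
Context (d : measure_display) (T : measurableType d) (P : probability T R).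
Local Open Scope classical_set_scope.

Definition past (e : nat -> T -> draw) (t : nat) (h : nat -> draw) : set T :=
  [set w | forall s, (s < t)%N -> e s w = h s].

(* The joint law of the draws e t = (xi^t, F^t): conditionally on the past, the
   mode is uniform, and conditionally on the past and on the mode n the m n
   columns are i.i.d. with distribution q. *)
Record sampling (e : nat -> T -> draw) : Prop := Sampling {
  sampling_measurable : forall t (c : draw), measurable [set w | e t w = c] ;
  sampling_mode : forall t h n,
    P (past e t h `&` [set w | tag (e t w) = n]) =
    ((N.+1)%:R^-1%:E * P (past e t h))%E ;
  sampling_columns : forall t h n (F : (m n).-tuple 'I_(J n)),
    P (past e t h `&` [set w | e t w = existT _ n F]) =
    ((\prod_l q (tnth F l))%:E *
     P (past e t h `&` [set w | tag (e t w) = n]))%E }.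

End Sampling.
End Algorithm.
End TensorRing.

(* Main.v *)
Require Import Defs.
From HB Require Import structures.
From mathcomp Require Import all_boot all_order all_algebra.
From mathcomp Require Import all_classical all_reals all_analysis.
From mathcomp Require Import measurable_realfun ring lra.

(** All finite histories of draws have positive probability, so the almost sure
    bound on the iterates holds along every history. Restricted to one core, the
    objective is a quadratic polynomial with linear part the partial gradient,
    and the sampled direction is an unbiased estimator of that gradient. Hence,
    on bounded cores, one step satisfies
      E[f(Y^(t+1)) | past] <= f(Y^t) - alpha^t / N ||grad f(Y^t)||^2
                              + B (alpha^t)^2.
    Summing over t bounds sum_t alpha^t E||grad f(Y^t)||^2, which together with
    sum_t alpha^t = oo forces the liminf to be 0. *)

Set Implicit Arguments.
Unset Strict Implicit.
Unset Printing Implicit Defensive.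

Import Order.TTheory GRing.Theory Num.Theory.
Import numFieldNormedType.Exports.

Local Open Scope classical_set_scope.
Local Open Scope ring_scope.

(** * Mixed-radix numbering of the columns of an unfolding *)

Section MixedRadix.
Variables (N : nat) (I : 'I_N.+1 -> nat) (I_gt0 : forall k, (0 < I k)%N).
Implicit Types n k : 'I_N.+1.

Lemma pos_inj n : injective (pos n).
Proof.
move=> k l /eqP; rewrite /pos eqn_modDr !modn_small ?ltn_ord // => /eqP.
exact: ord_inj.
Qed.

Lemma pos_self n : pos n n = N.
Proof. by rewrite /pos subnKC ?modn_small // -ltnS. Qed.

Lemma pos_ltn n k : (pos n k < N)%N = (k != n).
Proof.
have: (pos n k <= N)%N by rewrite -ltnS ltn_pmod.
rewrite leq_eqVlt; case: (eqVneq k n) => [-> _|kn].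
  by rewrite pos_self ltnn.
by rewrite -[X in _ == X](pos_self n) (inj_eq (@pos_inj n)) (negPf kn) /= => ->.
Qed.

Lemma pos_surj n s : (s < N)%N -> {k | pos n k = s}.
Proof.
(* Position 0 belongs to the mode after [n], so position [s] belongs to the mode [s] steps
   further. *)
move=> ltsN; exists (inord ((s + n.+1) %% N.+1)).
rewrite /pos inordK ?ltn_pmod // modnDml -addnA.
have -> : (n.+1 + (N - n) = N.+1)%N by rewrite addSn subnKC // -ltnS.
by rewrite modnDr modn_small // ltnW.
Qed.

(** The digits at positions below [s] determine [j] modulo the product of their radices, by
    induction on [s]. At [s = N] this modulus is [J I n], which exceeds both numbers. *)
Lemma digits_inj n (j j' : 'I_(J I n)) :
  (forall k, k != n -> digits I_gt0 j k = digits I_gt0 j' k) -> j = j'.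
Proof.
move=> eqd; apply: ord_inj.
have eqm s : (s <= N)%N ->
    j = j' %[mod \prod_(l | (pos n l < s)%N) I l].
  elim: s => [_|s IHs ltsN]; first by rewrite big_pred0 ?modn1.
  have [k pk] := pos_surj n ltsN.
  have -> : (\prod_(l | (pos n l < s.+1)%N) I l =
             I k * \prod_(l | (pos n l < s)%N) I l)%N.
    rewrite (bigD1 k) /=; last by rewrite pk.
    congr muln; apply: eq_bigl => l.
    by rewrite ltnS [in RHS]ltn_neqAle -{2}pk (inj_eq (@pos_inj n)) andbC.
  have kn : k != n by rewrite -pos_ltn pk.
  (* The digit at [k] is the quotient by the old modulus [a], reduced modulo [I k]; with the residue
     modulo [a] it gives the residue modulo [I k * a]. *)
  have /(congr1 val) /= := eqd k kn; rewrite /stride pk.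
  set a := (\prod_(l | _) _)%N => eqk.
  have eqa : j = j' %[mod a] by apply: IHs; rewrite ltnW.
  rewrite (divn_eq j a) (divn_eq j' a) eqa -modnDml -muln_modl eqk.
  by rewrite muln_modl modnDml.
have := eqm N (leqnn N).
have -> : (\prod_(l | (pos n l < N)%N) I l = J I n)%N.
  by apply: eq_bigl => l; rewrite pos_ltn.
by rewrite !modn_small.
Qed.

Lemma multi_indexE n (i : 'I_(I n)) (j : 'I_(J I n)) :
  multi_index I_gt0 i j n = i.
Proof. by rewrite ffunE dfwithin. Qed.

Lemma multi_index_neq n k (i : 'I_(I n)) (j : 'I_(J I n)) :
  k != n -> multi_index I_gt0 i j k = digits I_gt0 j k.
Proof. by move=> kn; rewrite ffunE dfwithout // eq_sym. Qed.

(** Injectivity comes from the digits; surjectivity follows because both sides have the same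
    cardinality. *)
Lemma multi_index_bij n :
  bijective (fun ij : 'I_(I n) * 'I_(J I n) => multi_index I_gt0 ij.1 ij.2).
Proof.
apply: inj_card_bij => [[i j] [i' j'] /= eqij|].
  congr pair; first by rewrite -(multi_indexE i j) eqij multi_indexE.
  apply: digits_inj => k kn.
  by rewrite -(multi_index_neq i) // eqij multi_index_neq.
rewrite card_prod !card_ord card_dep_ffun foldrE big_map big_enum /=.
under eq_bigr => k _ do rewrite card_ord.
by rewrite (bigD1 n).
Qed.

Lemma sum_multi_index (R : nmodType) n (F : mindex I -> R) :
  \sum_x F x = \sum_i \sum_j F (multi_index (n := n) I_gt0 i j).
Proof.
rewrite (reindex _ (onW_bij _ (multi_index_bij n))) /=.
by rewrite (pair_bigA _ (fun i j => F (multi_index I_gt0 i j))).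
Qed.

End MixedRadix.

(** Distributivity requires one index type for all inner sums, so each index is tagged by its mode;
    the choice functions that respect the tags correspond to the multi-indices. *)
Lemma bigA_distr_mindex (R : comPzSemiRingType) (N : nat) (I : 'I_N.+1 -> nat)
    (F : forall k, 'I_(I k) -> R) :
  \prod_k \sum_i F k i = \sum_(x : mindex I) \prod_k F k (x k).
Proof.
under eq_bigr => k _ do rewrite (big_tag F k).
rewrite bigA_distr_big_dep /=.
rewrite [RHS](reindex _ (onW_bij _ (dffun_of_fprod_bij _))) /=.
transitivity (\sum_(t : fprod (fun k => 'I_(I k)))
    \prod_(k in 'I_N.+1) (finfun (F k) : {ffun 'I_(I k) -> R}) (t k)).
  rewrite (big_fprod (I := 'I_N.+1) 1 _ (T_ := fun k => 'I_(I k))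
    (fun k => finfun (F k) : {ffun 'I_(I k) -> R})).
  apply: eq_bigr => g _; apply: eq_bigr => k _.
  by rewrite /untag; case: eqP => // e; rewrite ffunE.
by apply: eq_bigr => t _; apply: eq_bigr => k _; rewrite !ffunE.
Qed.

(** * Cyclic invariance of the tensor ring trace *)

Section TraceFormula.
Variables (R : realType) (N : nat) (I rk : 'I_N.+1 -> nat).
Hypothesis I_gt0 : forall k, (0 < I k)%N.
Implicit Types (n : 'I_N.+1) (X : tensor R I) (Y : cores R I rk).
Implicit Type x : forall k, 'I_(I k).

(** The product of all the sums of [p k] is 1. Expanded over multi-indices and split at mode [n], it
    factors as the sum of [p n] times the sum of [q]. *)
Lemma q_sum1 (p : forall k, 'I_(I k) -> R) :
  (forall k, \sum_i p k i = 1) -> forall n, \sum_j q I_gt0 p (n := n) j = 1.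
Proof.
move=> p1 n.
have prod_p (i : 'I_(I n)) (j : 'I_(J I n)) :
    \prod_k p k (multi_index I_gt0 i j k) = p n i * q I_gt0 p j.
  rewrite (bigD1 n) //= multi_indexE; congr (_ * _).
  by apply: eq_bigr => k kn; rewrite multi_index_neq.
have := bigA_distr_mindex p; rewrite big1 // (sum_multi_index I_gt0 n).
under eq_bigr => i _ do under eq_bigr => j _ do rewrite prod_p.
under eq_bigr => i _ do rewrite -mulr_sumr.
by rewrite -mulr_suml p1 mul1r => <-.
Qed.

Lemma chain_eq Y Y' x x' n k :
  (forall l, (l < k)%N -> let a := iter l (@ordS N.+1) n in
     Y a (x a) = Y' a (x' a)) ->
  chain Y x n k = chain Y' x' n k.
Proof.
elim: k => [//|k IHk] eqY /=; rewrite eqY // IHk // => l ltlk.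
by apply: eqY; rewrite ltnW.
Qed.

(** A chain is built by adding slices on the right, whereas the core to be isolated stands on the
    left. The cast is needed because the two end modes are equal but not convertible. *)
Lemma chain_cons Y x n k :
  chain Y x n k.+1 =
  castmx (erefl, congr1 rk (esym (iterSr k (@ordS N.+1) n)))
    (Y n (x n) *m chain Y x (ordS n) k).
Proof.
have cast_mul c c' (e : c = c') (A : 'M[R]_(rk (ordS n), rk c)) :
    castmx (erefl, congr1 rk e) (Y n (x n) *m A) *m Y c' (x c') =
    castmx (erefl, congr1 rk (congr1 (@ordS N.+1) e))
      (Y n (x n) *m (A *m Y c (x c))).
  by case: c' / e => /=; rewrite !castmx_id mulmxA.
elim: k => [|k IHk].
  by rewrite /= mul1mx mulmx1 (eq_irrelevance (esym _) erefl) castmx_id.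
rewrite [LHS]/= -[X in X *m _]/(chain Y x n k.+1) IHk cast_mul.
by congr (castmx (_, _) _); exact: eq_irrelevance.
Qed.

(** The trace of the closed chain that starts at an arbitrary mode [n]; [TR] is the case [ord0]. *)
Definition ring_trace Y x n : R :=
  \tr (castmx (erefl, congr1 rk (iter_ordS_cycle n)) (chain Y x n N.+1)).

Lemma ring_traceE Y x n :
  ring_trace Y x n =
  \tr (Y n (x n) *m
       castmx (erefl, congr1 rk (iter_ordS_next n)) (chain Y x (ordS n) N)).
Proof.
rewrite /ring_trace chain_cons.
have cast_trace a b (ab : a = b) (bn : b = n) (an : a = n)
      (A : 'M[R]_(rk (ordS n), rk a)) :
    \tr (castmx (erefl, congr1 rk bn)
          (castmx (erefl, congr1 rk ab) (Y n (x n) *m A))) =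
    \tr (Y n (x n) *m castmx (erefl, congr1 rk an) A).
  case: b / ab bn => bn; rewrite (eq_irrelevance an bn).
  by case: n / {an} bn A => A; rewrite !castmx_id.
exact: cast_trace.
Qed.

(** By [mxtrace_mulC], the slice of mode [n] moves from the front of the product to its end. *)
Lemma ring_trace_ordS Y x n : ring_trace Y x (ordS n) = ring_trace Y x n.
Proof.
rewrite [RHS]ring_traceE mxtrace_mulC /ring_trace.
have cast_trace a (an : a = n) (an' : ordS a = ordS n)
      (A : 'M[R]_(rk (ordS n), rk a)) :
    \tr (castmx (erefl, congr1 rk an') (A *m Y a (x a))) =
    \tr (castmx (erefl, congr1 rk an) A *m Y n (x n)).
  case: n / an A an' => A an'.
  by rewrite (eq_irrelevance an' erefl) !castmx_id.
exact: (cast_trace _ (iter_ordS_next n) (iter_ordS_cycle (ordS n))).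
Qed.

Lemma ring_trace_const Y x n n' : ring_trace Y x n = ring_trace Y x n'.
Proof.
suff ring_trace0 k : ring_trace Y x k = ring_trace Y x ord0.
  by rewrite ring_trace0 [RHS]ring_trace0.
have -> : k = iter k (@ordS N.+1) ord0.
  by apply: ord_inj; rewrite iter_ordS add0n modn_small.
by elim: {k}(nat_of_ord k) => [//|k IHk]; rewrite /= ring_trace_ordS.
Qed.

Lemma TR_ring_trace Y x n : TR Y (finfun x) = ring_trace Y x n.
Proof.
rewrite (ring_trace_const _ _ _ ord0) /ring_trace /TR; congr (\tr (castmx _ _)).
by apply: chain_eq => l _ /=; rewrite ffunE.
Qed.
End TraceFormula.

(** * The Frobenius inner product and the derivative of a quadratic *)

Section Frobenius.
Variable R : realType.

Definition frob m n (A B : 'M[R]_(m, n)) : R := \sum_i \sum_j A i j * B i j.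

Lemma sqfrobE m n (A : 'M[R]_(m, n)) : sqfrob A = frob A A.
Proof. by apply: eq_bigr => i _; apply: eq_bigr => j _; rewrite expr2. Qed.

Lemma sqfrob_ge0 m n (A : 'M[R]_(m, n)) : 0 <= sqfrob A.
Proof. by apply: sumr_ge0 => i _; apply: sumr_ge0 => j _; rewrite sqr_ge0. Qed.

Lemma frobDr m n (A B C : 'M[R]_(m, n)) : frob A (B + C) = frob A B + frob A C.
Proof.
rewrite -big_split /=; apply: eq_bigr => i _; rewrite -big_split /=.
by apply: eq_bigr => j _; rewrite !mxE mulrDr.
Qed.

Lemma frobC m n (A B : 'M[R]_(m, n)) : frob A B = frob B A.
Proof. by apply: eq_bigr => i _; apply: eq_bigr => j _; rewrite mulrC. Qed.

Lemma frobZr m n a (A B : 'M[R]_(m, n)) : frob A (a *: B) = a * frob A B.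
Proof.
rewrite mulr_sumr; apply: eq_bigr => i _; rewrite mulr_sumr.
by apply: eq_bigr => j _; rewrite !mxE mulrCA.
Qed.

Lemma frob_delta m n (A : 'M[R]_(m, n)) i j : frob A (delta_mx i j) = A i j.
Proof.
rewrite /frob (bigD1 i) //= (bigD1 j) //= mxE !eqxx mulr1.
rewrite big1 ?addr0; last first.
  by move=> k /negPf kj; rewrite mxE kj andbF mulr0.
rewrite big1 ?addr0 // => k /negPf ki; rewrite big1 // => l _.
by rewrite mxE ki mulr0.
Qed.

Lemma frob_mul_tr m n k (A : 'M[R]_(m, n)) (B : 'M[R]_(m, k))
    (C : 'M[R]_(n, k)) :
  frob A (B *m C^T) = frob (A *m C) B.
Proof.
apply: eq_bigr => i _.
under eq_bigr => j _ do rewrite mxE mulr_sumr.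
rewrite exchange_big /=; apply: eq_bigr => l _; rewrite mxE mulr_suml.
by apply: eq_bigr => j _; rewrite mxE; ring.
Qed.

Lemma sqfrobD m n (A B : 'M[R]_(m, n)) :
  sqfrob (A + B) = sqfrob A + 2 * frob A B + sqfrob B.
Proof.
rewrite !sqfrobE frobDr ![frob (A + B) _]frobC !frobDr (frobC B A).
by ring.
Qed.

Lemma sqfrobZ m n a (A : 'M[R]_(m, n)) : sqfrob (a *: A) = a ^+ 2 * sqfrob A.
Proof. by rewrite !sqfrobE frobZr frobC frobZr mulrA expr2. Qed.

Lemma derive1_quadratic (a b c : R) :
  derive1 (fun h => a + h * b + h ^+ 2 * c) 0 = b.
Proof.
have -> : (fun h => a + h * b + h ^+ 2 * c) =
    horner (a%:P + b *: 'X + c *: 'X^2).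
  apply/funext => h.
  by rewrite !(hornerD, hornerC, hornerZ, hornerX, hornerXn); ring.
rewrite -derivE !poly.derivE mul1r mulr1.
by rewrite !(hornerD, hornerC, hornerZ, hornerX) add0r addr0 mulr0 addr0 mulr1.
Qed.
End Frobenius.

(** * The objective as a quadratic in one core, and the unbiased estimator *)

Section Objective.
Variables (R : realType) (N : nat) (I rk : 'I_N.+1 -> nat).
Hypothesis I_gt0 : forall k, (0 < I k)%N.
Variable X : tensor R I.
Implicit Types (n : 'I_N.+1) (Y : cores R I rk).
Local Notation subchain2 := (subchain2 I_gt0).
Local Notation unfold_tensor := (unfold_tensor I_gt0).

Lemma iter_ordS_neq n l : (l < N)%N -> iter l (@ordS N.+1) (ordS n) != n.
Proof.
move=> ltlN; rewrite -iterSr; apply/eqP => /(congr1 val).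
rewrite [LHS]iter_ordS => /eqP.
rewrite -[X in _ == X](modn_small (ltn_ord n)) -[X in _ == X %[mod _]]addn0.
by rewrite eqn_modDl !modn_small.
Qed.

Lemma fold2_trace n (M : 'M[R]_(I n, rk (ordS n) * rk n)) i
    (S : 'M[R]_(rk (ordS n), rk n)) :
  \tr (fold2 M i *m S) = \sum_c M i c * mxvec S 0 c.
Proof.
rewrite (reindex _ (curry_mxvec_bij _ _)) /=.
rewrite mxtrace_mulC.
transitivity (\sum_a \sum_b
    M i (mxvec_index a b) * mxvec S 0 (mxvec_index a b));
  last by rewrite pair_bigA; apply: eq_bigr => -[a b].
apply: eq_bigr => a _; rewrite !mxE; apply: eq_bigr => b _.
by rewrite mxvecE !mxE mulrC.
Qed.

(** The ring is opened at mode [n]: its slice comes first, and the other [N] factors never return to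
    [n], hence are the same for [Y] as for the modified cores. *)
Lemma TR_set_core Y n (M : 'M[R]_(I n, rk (ordS n) * rk n)) i j :
  TR (set_core Y M) (multi_index I_gt0 i j) = (M *m (subchain2 Y n)^T) i j.
Proof.
rewrite (TR_ring_trace _ _ n) ring_traceE /set_core !dfwithin.
rewrite (@chain_eq _ _ _ _ _ Y _ (digits I_gt0 j)) => [|l ltlN a].
  by rewrite fold2_trace mxE; apply: eq_bigr => c _; rewrite !mxE.
by rewrite !dfwithout // eq_sym iter_ordS_neq.
Qed.

Lemma objective_set_core Y n (M : 'M[R]_(I n, rk (ordS n) * rk n)) :
  objective X (set_core Y M) =
  2^-1 * sqfrob (M *m (subchain2 Y n)^T - unfold_tensor X n).
Proof.
rewrite /objective (sum_multi_index I_gt0 n); congr (_ * _).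
apply: eq_bigr => i _; apply: eq_bigr => j _.
by rewrite TR_set_core !mxE.
Qed.

Lemma set_core_id Y n : set_core Y (unfold2 (Y n)) = Y.
Proof.
apply: functional_extensionality_dep => k; rewrite /set_core unfold2K.
by case: (eqVneq n k) => [<-|nk]; rewrite ?dfwithin ?dfwithout.
Qed.

Definition residual Y n :=
  unfold2 (Y n) *m (subchain2 Y n)^T - unfold_tensor X n.

(** The residual is affine in a single core, so this second-order expansion is exact; it yields both
    the gradient and the effect of a step. *)
Lemma objective_set_coreD Y n (D : 'M[R]_(I n, rk (ordS n) * rk n)) :
  objective X (set_core Y (unfold2 (Y n) + D)) =
  objective X Y + frob (residual Y n *m subchain2 Y n) D
    + 2^-1 * sqfrob (D *m (subchain2 Y n)^T).
Proof.
have -> : objective X Y = 2^-1 * sqfrob (residual Y n).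
  by rewrite -[in LHS](set_core_id Y n) objective_set_core.
rewrite objective_set_core mulmxDl addrAC -/(residual Y n) sqfrobD frob_mul_tr.
by field.
Qed.

(** Along each coordinate direction the objective is a quadratic in [h], whose linear coefficient is
    an entry of the right-hand side. *)
Lemma gradientE Y n : gradient X Y n = residual Y n *m subchain2 Y n.
Proof.
apply/matrixP => i c; rewrite mxE -[RHS]frob_delta.
under [X in derive1 X]eq_fun => h.
  rewrite objective_set_coreD frobZr -scalemxAl sqfrobZ mulrCA; over.
exact: derive1_quadratic.
Qed.

(** The marginal law of one of [k] independent draws: after distributing, every position other than
    [l0] contributes a factor 1. *)
Lemma sum_tuple_tnth (J' : finType) k (l0 : 'I_k) (w g : J' -> R) :
  \sum_j w j = 1 ->
  \sum_(F : k.-tuple J') (\prod_l w (tnth F l)) * g (tnth F l0) =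
  \sum_j w j * g j.
Proof.
move=> w1; pose h l j := w j * (if l == l0 then g j else 1).
transitivity (\prod_l \sum_j h l j); last first.
  rewrite (bigD1 l0) //= [X in _ * X]big1 ?mulr1 => [|l /negPf ll0].
    by apply: eq_bigr => j _; rewrite /h eqxx.
  by rewrite -[RHS]w1; apply: eq_bigr => j _; rewrite /h ll0 mulr1.
rewrite bigA_distr_bigA /=.
rewrite (reindex _ (onW_bij _ (Bijective finfun_of_tupleK tuple_of_finfunK))).
apply: eq_bigr => F _; rewrite big_split /=; congr (_ * _).
  by apply: eq_bigr => l _; rewrite ffunE.
by rewrite -big_mkcond big_pred1_eq ffunE.
Qed.

Lemma sum_tuple_prod (J' : finType) k (w : J' -> R) :
  \sum_j w j = 1 -> \sum_(F : k.-tuple J') \prod_l w (tnth F l) = 1.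
Proof.
move=> w1.
rewrite (reindex _ (onW_bij _ (Bijective tuple_of_finfunK finfun_of_tupleK))).
under eq_bigr => F _ do under eq_bigr => l _ do rewrite tnth_mktuple.
by rewrite -(bigA_distr_bigA (fun _ : 'I_k => w)) big1.
Qed.

Variables (m : 'I_N.+1 -> nat) (p : forall k, 'I_(I k) -> R).
Hypothesis m_gt0 : forall n, (0 < m n)%N.
Hypothesis p_gt0 : forall k i, 0 < @p k i.
Hypothesis p_sum1 : forall k, \sum_i @p k i = 1.

Lemma q_gt0 n j : 0 < q I_gt0 p (n := n) j.
Proof. exact: prodr_gt0. Qed.

(* The coefficient of [a ^+ 2] in the objective after a step of size [a]. *)
Definition curvature Y (c : draw I m) : R :=
  2^-1 * sqfrob (estimator I_gt0 p X Y (tagged c) *m (subchain2 Y (tag c))^T).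

Lemma estimatorE Y n (F : (m n).-tuple 'I_(J I n)) i c :
  estimator I_gt0 p X Y F i c =
  (m n)%:R^-1 * \sum_l residual Y n i (tnth F l) *
    subchain2 Y n (tnth F l) c * (q I_gt0 p (tnth F l))^-1.
Proof.
rewrite /estimator mxE; congr (_ * _).
rewrite -!mulmxBl mxE; apply: eq_bigr => l _.
rewrite mul_mx_diag !mxE -!mulrA; congr (_ * _); last exact: mulrC.
by congr (_ - _); apply: eq_bigr => c' _; rewrite !mxE.
Qed.

(** The factor [1 / q] cancels the sampling probability of a column, so each of the [m n] draws has
    the full gradient entry as its mean, and [1 / m n] averages these equal terms. *)
Lemma estimator_unbiased Y n i c :
  \sum_(F : (m n).-tuple 'I_(J I n)) (\prod_l q I_gt0 p (tnth F l)) *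
    estimator I_gt0 p X Y F i c = gradient X Y n i c.
Proof.
under eq_bigr => F _ do rewrite estimatorE mulrCA mulr_sumr.
rewrite -mulr_sumr exchange_big /= gradientE mxE.
under eq_bigr => l _.
  rewrite (@sum_tuple_tnth _ _ l _ (fun j => residual Y n i j *
    subchain2 Y n j c * (q I_gt0 p j)^-1)) ?q_sum1 //.
  under eq_bigr => j _ do
    rewrite mulrC mulfVK ?gt_eqF ?q_gt0 //.
  over.
rewrite sumr_const card_ord -[X in _ * X]mulr_natl mulKf //.
by rewrite pnatr_eq0 -lt0n.
Qed.
End Objective.

(** * Closure properties of functions bounded on a set *)

Section BoundedFunctions.
Variables (R : realType) (S : Type) (D : set S).
Implicit Types f g : S -> R.

Definition bounded_in f := exists B, forall y, D y -> `|f y| <= B.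

Lemma bounded_in_cst (c : R) : bounded_in (fun=> c).
Proof. by exists `|c|. Qed.

Lemma bounded_inD f g :
  bounded_in f -> bounded_in g -> bounded_in (fun y => f y + g y).
Proof.
move=> [B fB] [B' gB]; exists (B + B') => y Dy.
by rewrite (le_trans (ler_normD _ _)) // lerD ?fB ?gB.
Qed.

Lemma bounded_inM f g :
  bounded_in f -> bounded_in g -> bounded_in (fun y => f y * g y).
Proof.
move=> [B fB] [B' gB]; exists (B * B') => y Dy.
by rewrite normrM ler_pM ?fB ?gB.
Qed.

Lemma bounded_in_sum (A : finType) (f : A -> S -> R) :
  (forall a, bounded_in (f a)) -> bounded_in (fun y => \sum_a f a y).
Proof.
move=> /(_ _)/cid-/all_sig[B fB]; exists (\sum_a B a) => y Dy.
by rewrite (le_trans (ler_norm_sum _ _ _)) // ler_sum // => a _; exact: fB.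
Qed.

Lemma bounded_in_fin (A : finType) (f : A -> S -> R) :
  (forall a, bounded_in (f a)) ->
  exists B, forall a y, D y -> `|f a y| <= B.
Proof.
move=> bf; have [B Bf] : bounded_in (fun y => \sum_a `|f a y|).
  apply: bounded_in_sum => a; have [B fB] := bf a.
  by exists B => y Dy; rewrite normr_id fB.
exists B => a y Dy; apply: le_trans (Bf y Dy).
apply: le_trans (ler_norm _); rewrite (bigD1 a) //= lerDl.
by apply: sumr_ge0 => *; exact: normr_ge0.
Qed.

Lemma bounded_in_mulmx a b c (A : S -> 'M[R]_(a, b)) (B : S -> 'M[R]_(b, c)) :
  (forall i j, bounded_in (fun y => A y i j)) ->
  (forall i j, bounded_in (fun y => B y i j)) ->
  forall i j, bounded_in (fun y => (A y *m B y) i j).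
Proof.
move=> bA bB i j; under eq_fun do rewrite mxE.
by apply: bounded_in_sum => k; exact: bounded_inM.
Qed.

Lemma bounded_in_sqfrob a b (A : S -> 'M[R]_(a, b)) :
  (forall i j, bounded_in (fun y => A y i j)) ->
  bounded_in (fun y => sqfrob (A y)).
Proof.
move=> bA; do 2!apply: bounded_in_sum => ?.
by under eq_fun do rewrite expr2; exact: bounded_inM.
Qed.

End BoundedFunctions.

(** * A uniform curvature bound on bounded cores *)

Section BoundedCores.
Variables (R : realType) (N : nat) (I rk : 'I_N.+1 -> nat).
Hypothesis I_gt0 : forall k, (0 < I k)%N.
Variables (X : tensor R I) (m : 'I_N.+1 -> nat) (p : forall k, 'I_(I k) -> R).
Variable C : R.
Implicit Types n : 'I_N.+1.

Definition bounded_cores : set (cores R I rk) :=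
  [set Y | forall n, Num.sqrt (sqfrob (unfold2 (Y n))) <= C].

Local Notation bounded := (bounded_in bounded_cores).

Lemma bounded_unfold2 n i c : bounded (fun Y => unfold2 (Y n) i c).
Proof.
exists C => Y /(_ n); apply: le_trans; rewrite -sqrtr_sqr ler_wsqrtr //.
rewrite /sqfrob (bigD1 i) //= (bigD1 c) //= -addrA lerDl addr_ge0 //.
  by apply: sumr_ge0 => *; exact: sqr_ge0.
by apply: sumr_ge0 => *; apply: sumr_ge0 => *; exact: sqr_ge0.
Qed.

Lemma bounded_core_entry n v a b : bounded (fun Y => Y n v a b).
Proof.
have [B HB] := bounded_unfold2 (n := n) v (mxvec_index b a).
by exists B => Y /HB; rewrite mxE mxvecE mxE.
Qed.

Lemma bounded_chain x n k i j : bounded (fun Y => chain Y x n k i j).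
Proof.
elim: k i j => [|k IHk] i j; first exact: bounded_in_cst.
apply: bounded_in_mulmx => // {IHk i j} i j.
exact: bounded_core_entry.
Qed.

Lemma bounded_subchain2 n j c : bounded (fun Y => subchain2 I_gt0 Y n j c).
Proof.
case/mxvec_indexP: c => a b.
under eq_fun => Y do rewrite mxE mxvecE castmxE.
exact: bounded_chain.
Qed.

Lemma bounded_estimator n F i c :
  bounded (fun Y => estimator (m := m) (n := n) I_gt0 p X Y F i c).
Proof.
under eq_fun => Y do rewrite estimatorE.
apply: bounded_inM; first exact: bounded_in_cst.
apply: bounded_in_sum => l; apply: bounded_inM; last exact: bounded_in_cst.
apply: bounded_inM; last exact: bounded_subchain2.
under eq_fun => Y do rewrite !mxE.
apply: bounded_inD; last exact: bounded_in_cst.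
apply: bounded_in_sum => c'; apply: bounded_inM; first exact: bounded_unfold2.
by under eq_fun => Y do rewrite mxE; exact: bounded_subchain2.
Qed.

(** For a fixed draw the curvature is a polynomial in the core entries, hence bounded on bounded
    cores; there are finitely many draws, so one [B] serves them all. *)
Lemma curvature_bound :
  exists B : R, forall (c : draw I m) Y, bounded_cores Y ->
    curvature I_gt0 X p Y c <= B.
Proof.
pose A : finType := {n : 'I_N.+1 & (m n).-tuple 'I_(J I n)}.
have [c|B HB] := @bounded_in_fin _ _ bounded_cores A
  (fun c Y => curvature I_gt0 X p Y c).
  apply: bounded_inM; first exact: bounded_in_cst.
  apply: bounded_in_sqfrob; apply: bounded_in_mulmx => i j.
    exact: bounded_estimator.
  by under eq_fun => Y do rewrite mxE; exact: bounded_subchain2.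
by exists B => c Y DY; apply: le_trans (HB c Y DY); exact: ler_norm.
Qed.
End BoundedCores.

Lemma probability_inhabited (R : realType) d (T : measurableType d)
  (P : probability T R) : [set: T] !=set0.
Proof.
apply/set0P/negP => /eqP T0; have := probability_setT P.
by rewrite T0 measure0 => /eqP; rewrite eq_sym onee_eq0.
Qed.

(** * Expected descent of one step and its summation over time *)

Section ExpectedDescent.
Variables (R : realType) (N : nat) (I rk : 'I_N.+1 -> nat).
Hypothesis I_gt0 : forall k, (0 < I k)%N.
Variables (X : tensor R I) (m : 'I_N.+1 -> nat) (p : forall k, 'I_(I k) -> R).
Hypothesis m_gt0 : forall n, (0 < m n)%N.
Hypothesis p_gt0 : forall k i, 0 < @p k i.
Hypothesis p_sum1 : forall k, \sum_i @p k i = 1.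
Implicit Types (Y : cores R I rk) (phi : cores R I rk -> R).

(* [draw] as a finite type, which its definition hides. *)
Let drawf : finType := {n : 'I_N.+1 & (m n).-tuple 'I_(J I n)}.

(** The conditional probability of the draw [c] given the past. *)
Definition weight (c : draw I m) : R :=
  N.+1%:R^-1 * \prod_l q I_gt0 p (tnth (tagged c) l).

Lemma weight_gt0 c : 0 < weight c.
Proof.
rewrite mulr_gt0 ?invr_gt0 ?ltr0n //.
by apply: prodr_gt0 => l _; exact: q_gt0.
Qed.

Lemma sum_weight (F : draw I m -> R) :
  \sum_(c : drawf) weight c * F c =
  N.+1%:R^-1 * \sum_n \sum_(U : (m n).-tuple 'I_(J I n))
    (\prod_l q I_gt0 p (tnth U l)) * F (existT _ n U).
Proof.
rewrite mulr_sumr; under [RHS]eq_bigr => n _ do rewrite mulr_sumr.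
rewrite sig_big_dep /=; apply: eq_bigr => -[n U] _.
by rewrite /weight mulrA.
Qed.

Lemma sum_weight1 : \sum_(c : drawf) weight c = 1.
Proof.
under eq_bigr => c _ do rewrite -[weight c]mulr1.
rewrite (sum_weight (fun=> 1)).
under eq_bigr => n _ do under eq_bigr => U _ do rewrite mulr1.
under eq_bigr => n _ do rewrite sum_tuple_prod ?q_sum1 //.
by rewrite sumr_const card_ord mulVf // pnatr_eq0.
Qed.

Lemma objective_step a Y (c : draw I m) :
  objective X (step I_gt0 p X a Y c) =
  objective X Y
    - a * frob (gradient X Y (tag c)) (estimator I_gt0 p X Y (tagged c))
    + a ^+ 2 * curvature I_gt0 X p Y c.
Proof.
rewrite /step -scaleNr (objective_set_coreD I_gt0) -(gradientE I_gt0).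
by rewrite frobZr -scalemxAl sqfrobZ sqrrN mulNr /curvature mulrCA.
Qed.

Lemma sum_weight_frob Y :
  \sum_(c : drawf) weight c *
    frob (gradient X Y (tag c)) (estimator I_gt0 p X Y (tagged c)) =
  N.+1%:R^-1 * sqnorm_gradient X Y.
Proof.
rewrite (sum_weight (fun c => frob (gradient X Y (tag c))
  (estimator I_gt0 p X Y (tagged c)))) /=; congr (_ * _).
apply: eq_bigr => n _; rewrite sqfrobE.
under eq_bigr => U _ do rewrite mulr_sumr.
rewrite exchange_big /=; apply: eq_bigr => i _.
under eq_bigr => U _ do rewrite mulr_sumr.
rewrite exchange_big /=; apply: eq_bigr => j _.
under eq_bigr => U _ do rewrite mulrCA.
by rewrite -mulr_sumr (estimator_unbiased I_gt0).
Qed.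

(** The expansion of [objective_step] is averaged over the draws: unbiasedness turns the linear term
    into the squared gradient norm, and [B] bounds the quadratic term. *)
Lemma expected_descent a B Y :
  (forall c : draw I m, curvature I_gt0 X p Y c <= B) ->
  \sum_(c : drawf) weight c * objective X (step I_gt0 p X a Y c) <=
  objective X Y - a / N.+1%:R * sqnorm_gradient X Y + a ^+ 2 * B.
Proof.
move=> leB.
have : \sum_(c : drawf) weight c * objective X (step I_gt0 p X a Y c) <=
    \sum_(c : drawf) (weight c * (objective X Y + a ^+ 2 * B) - a * (weight c *
      frob (gradient X Y (tag c)) (estimator I_gt0 p X Y (tagged c)))).
  apply: ler_sum => c _; rewrite [a * (weight c * _)]mulrCA -mulrBr.
  rewrite ler_pM2l ?weight_gt0 //.
  by rewrite objective_step addrAC lerD2r lerD2l ler_wpM2l ?sqr_ge0.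
rewrite sumrB -mulr_suml sum_weight1 -mulr_sumr sum_weight_frob.
move=> /le_trans; apply.
by rewrite mul1r mulrA addrAC.
Qed.

Variable alpha : nat -> R.

(** The conditional expectation of [phi] at iterate [t + k] given that iterate [t] is [Y], as a
    nested finite sum over the next [k] draws. *)
Fixpoint mean (t k : nat) phi Y : R :=
  if k is k'.+1 then
    \sum_(c : drawf) weight c * mean t.+1 k' phi (step I_gt0 p X (alpha t) Y c)
  else phi Y.

Lemma mean_ge0 t k phi Y : (forall Y, 0 <= phi Y) -> 0 <= mean t k phi Y.
Proof.
move=> phi_ge0; elim: k t Y => [|k IHk] t Y //=.
by apply: sumr_ge0 => c _; rewrite mulr_ge0 // ltW // weight_gt0.
Qed.

Variable Y0 : cores R I rk.
Local Notation iterate := (@Defs.iterate R N I rk I_gt0 m p X alpha Y0).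

Definition update (h : nat -> draw I m) t c s := if s == t then c else h s.

Lemma iterate_eq h h' t :
  (forall s, (s < t)%N -> h s = h' s) -> iterate h t = iterate h' t.
Proof.
elim: t => [//|t IHt] eqh; rewrite /= eqh // IHt // => s ltst.
by apply: eqh; rewrite ltnW.
Qed.

Lemma iterate_update h t c :
  iterate (update h t c) t.+1 = step I_gt0 p X (alpha t) (iterate h t) c.
Proof.
rewrite /= {2}/update eqxx; congr step; apply: iterate_eq => s ltst.
by rewrite /update ltn_eqF.
Qed.

Lemma objective_ge0 Y : 0 <= objective X Y.
Proof.
by rewrite mulr_ge0 ?invr_ge0 //; apply: sumr_ge0 => x _; exact: sqr_ge0.
Qed.

(** Induction on [k] for all [t] and [h]: the descent inequality handles time [t], and the induction
    hypothesis, averaged over the next draw, handles the later times. The objectives telescope, and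
    the last one is dropped because it is nonnegative. *)
Lemma sum_mean_gradient_le B k t h :
  (forall h t (c : draw I m), curvature I_gt0 X p (iterate h t) c <= B) ->
  \sum_(0 <= s < k) alpha (t + s) / N.+1%:R *
    mean t s (sqnorm_gradient X) (iterate h t) <=
  objective X (iterate h t) + B * \sum_(0 <= s < k) alpha (t + s) ^+ 2.
Proof.
move=> leB; elim: k t h => [|k IHk] t h.
  by rewrite !big_nil mulr0 addr0 objective_ge0.
rewrite !big_nat_recl // !addn0 /=.
under eq_bigr => s _ do rewrite addnS -addSn mulr_sumr.
under [\sum_(0 <= s < k) alpha _ ^+ 2]eq_bigr => s _ do rewrite addnS -addSn.
have := expected_descent (alpha t) (leB h t).
set S := \sum_(0 <= s < k) alpha _ ^+ 2.
have {IHk} : \sum_(0 <= s < k) \sum_(c : drawf) alpha (t.+1 + s) / N.+1%:R *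
      (weight c * mean t.+1 s (sqnorm_gradient X)
        (step I_gt0 p X (alpha t) (iterate h t) c)) <=
    \sum_(c : drawf) (weight c * objective X
      (step I_gt0 p X (alpha t) (iterate h t) c) + weight c * (B * S)).
  rewrite exchange_big; apply: ler_sum => c _; rewrite -mulrDr.
  under eq_bigr => s _ do rewrite mulrCA.
  rewrite -mulr_sumr ler_pM2l ?weight_gt0 // -iterate_update.
  exact: IHk.
rewrite big_split -mulr_suml sum_weight1 /= mul1r => le1 le2.
set A := alpha t / _ * _ in le2 *; set V := \sum_(0 <= s < k) _ in le1 *.
set W := \sum_(c : drawf) _ in le1 le2; clearbody A V W; lra.
Qed.

(** * From the law of the draws to expectations of the iterates *)

Section Sampling.
Context (d : measure_display) (T : measurableType d) (P : probability T R).
Variable e : nat -> T -> draw I m.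
Hypothesis e_sampling : sampling I_gt0 p P e.

Lemma past0 h : past e 0 h = setT.
Proof. by apply/seteqP; split. Qed.

Lemma pastS t h : past e t.+1 h = past e t h `&` [set w | e t w = h t].
Proof.
apply/seteqP; split=> [w hw|w [hw ew] s].
  by split=> [s ltst|]; apply: hw; rewrite // ltnW.
by rewrite ltnS leq_eqVlt => /predU1P[->|/hw].
Qed.

Lemma past_measurable t h : measurable (past e t h).
Proof.
elim: t => [|t IHt]; first by rewrite past0; exact: measurableT.
rewrite pastS; apply: measurableI => //.
exact: (sampling_measurable e_sampling).
Qed.

Lemma past_eq h h' t :
  (forall s, (s < t)%N -> h s = h' s) -> past e t h = past e t h'.
Proof.
by move=> eqh; apply/seteqP; split=> w hw s ltst; rewrite hw // eqh.
Qed.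

Lemma pastS_update t h c :
  past e t.+1 (update h t c) = past e t h `&` [set w | e t w = c].
Proof.
rewrite pastS {2}/update eqxx; congr (_ `&` _); apply: past_eq => s ltst.
by rewrite /update ltn_eqF.
Qed.

Lemma probability_pastS t h :
  P (past e t.+1 h) = ((weight (h t))%:E * P (past e t h))%E.
Proof.
rewrite pastS /weight; case: (h t) => n F /=.
rewrite (sampling_columns e_sampling) (sampling_mode e_sampling).
by rewrite muleA -EFinM mulrC.
Qed.

Lemma probability_past_gt0 t h : (0 < P (past e t h))%E.
Proof.
elim: t => [|t IHt]; first by rewrite past0 probability_setT lte01.
by rewrite probability_pastS mule_gt0 // lte_fin weight_gt0.
Qed.

(** A history violating [D] would put an event of positive probability inside a null set. *)
Lemma ae_iterate (D : set (cores R I rk)) :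
  {ae P, forall w, forall t, D (iterate (fun s => e s w) t)} ->
  forall h t, D (iterate h t).
Proof.
move=> [A [mA PA0 subA]] h t; apply: contrapT => notD.
have : (P (past e t h) <= P A)%E.
  rewrite le_measure ?inE //; first exact: past_measurable.
  move=> w hw; apply: subA => /= /(_ t).
  by rewrite (@iterate_eq _ h).
by rewrite PA0 leNgt probability_past_gt0.
Qed.

Lemma past_bigsetU t h :
  past e t h = \big[setU/set0]_(c : drawf) past e t.+1 (update h t c).
Proof.
rewrite -bigcup_seq; apply/seteqP; split=> [w hw|w [c _]].
  by exists (e t w); rewrite /= ?mem_index_enum // pastS_update.
by rewrite pastS_update => -[].
Qed.

(** The event is split according to the draw at time [t], down to events on which the integrand is
    constant. Measurability is carried along because additivity of the integral over the pieces
    requires it. *)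
Lemma integral_past phi (phi_ge0 : forall Y, 0 <= phi Y) k t h :
  let f : T -> \bar R := fun w => (phi (iterate (fun s => e s w) (t + k)))%:E in
  measurable_fun (past e t h) f /\
  (\int[P]_(w in past e t h) f w =
   (mean t k phi (iterate h t))%:E * P (past e t h))%E.
Proof.
elim: k t h => [|k IHk] t h /=.
  have eqf : {in past e t h, cst (phi (iterate h t))%:E =1
      fun w => (phi (iterate (fun s => e s w) (t + 0)))%:E}.
    by move=> w /set_mem hw; rewrite /cst addn0 (@iterate_eq _ h).
  split; first by apply: (eq_measurable_fun _ eqf); exact: measurable_cst.
  by rewrite -(eq_integral _ _ eqf) integral_cst //; exact: past_measurable.
rewrite addnS -addSn.
set f := fun w => _; rewrite [past e t h]past_bigsetU.
have mf : measurable_fun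
    (\big[setU/set0]_(c : drawf) past e t.+1 (update h t c)) f.
  elim: (index_enum drawf) => [|c s IHs].
    by rewrite big_nil; exact: measurable_fun_set0.
  rewrite big_cons; apply/measurable_funU; [exact: past_measurable| |].
    by apply: bigsetU_measurable => c' _; exact: past_measurable.
  by split=> //; have [] := IHk t.+1 (update h t c).
split=> //; rewrite (ge0_integral_bigsetU P) //.
- rewrite -past_bigsetU -sumEFin ge0_sume_distrl; last first.
    by move=> c _; rewrite lee_fin mulr_ge0 ?mean_ge0 // ltW // weight_gt0.
  apply: eq_bigr => c _; have [_ ->] := IHk t.+1 (update h t c).
  rewrite iterate_update probability_pastS /update eqxx.
  rewrite (@past_eq _ h) => [|s ltst]; last by rewrite ltn_eqF.
  by rewrite muleA -EFinM mulrC.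
- by move=> c; exact: past_measurable.
- exact: index_enum_uniq.
- apply/trivIsetP => c c' _ _ /eqP cc'; apply/seteqP; split=> // w.
  by rewrite !pastS_update => -[[_ /= ec] [_ /= ec']]; apply: cc'; rewrite -ec.
- by move=> w _; rewrite lee_fin.
Qed.

Lemma expectation_iterate phi k (phi_ge0 : forall Y, 0 <= phi Y) :
  ('E_P[fun w => phi (iterate (fun s => e s w) k)])%E = (mean 0 k phi Y0)%:E.
Proof.
have [w0 _] := probability_inhabited P.
have [_] := integral_past phi_ge0 k 0 (fun s => e s w0).
by rewrite unlock past0 probability_setT mule1.
Qed.
End Sampling.
End ExpectedDescent.

(** * Vanishing lower limit from a weighted sum bound, and the conclusion *)

Lemma limn_einf_eq0 (R : realType) (a u : nat -> R) (K : R) :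
  (forall t, 0 < a t) -> (forall t, 0 <= u t) ->
  (\sum_(0 <= t <oo) (a t)%:E = +oo)%E ->
  (forall k, \sum_(0 <= t < k) a t * u t <= K) ->
  limn_einf (fun t => (u t)%:E) = 0%E.
Proof.
move=> a_gt0 u_ge0 a_sum leK; rewrite limn_einf_lim.
suff -> : einfs (fun t => (u t)%:E) = cst 0%E by exact: lim_cst.
apply/funext => n; apply/eqP; rewrite eq_le; apply/andP; split; last first.
  by apply: le_ereal_inf_tmp => _ [k _ <-]; rewrite lee_fin.
(* A positive tail infimum bounds [u] below by some [eps > 0] from [n] on, so the tail sum of [a] is
   at most [K / eps], against divergence. *)
rewrite leNgt; apply/negP => inf_gt0.
have [eps eps_gt0 le_u] :
    exists2 eps, 0 < eps & forall k, (n <= k)%N -> eps <= u k.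
  have le_inf k : (n <= k)%N -> (einfs (fun t => (u t)%:E) n <= (u k)%:E)%E.
    by move=> nk; apply: ereal_inf_lbound; exists k.
  (* The infimum is finite, being at most the real number [u n]; hence it can serve as [eps]. *)
  move: inf_gt0 le_inf; case: (einfs _ n) => [r|/= _ /(_ n (leqnn n))|] //.
  by rewrite lte_fin => r_gt0 le_r; exists r => // k nk; rewrite -lee_fin le_r.
have : (\sum_(n <= t <oo) (a t)%:E <= (K / eps)%:E)%E.
  apply: lime_le.
    by apply: is_cvg_nneseries => t _ _; rewrite lee_fin ltW.
  apply: nearW => k; rewrite sumEFin lee_fin ler_pdivlMr // mulr_suml.
  apply: le_trans (leK k); have [nk|/ltnW kn] := leqP n k; last first.
    by rewrite big_geq // sumr_ge0 // => t _; rewrite mulr_ge0 // ltW.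
  rewrite (big_cat_nat (leq0n n) nk) /= -[X in X <= _]add0r lerD //.
    by rewrite sumr_ge0 // => t _; rewrite mulr_ge0 // ltW.
  rewrite !big_nat ler_sum // => t /andP[nt _].
  by rewrite ler_pM2l // le_u.
move: a_sum; rewrite (@nneseries_split _ _ 0 n); last first.
  by move=> k _; rewrite lee_fin ltW.
rewrite add0n sumEFin; case: (\sum_(n <= t <oo) _)%E => //=.
Qed.

Theorem theorem3p1 (R : realType) (N : nat) (I rk : 'I_N.+1 -> nat)
    (I_gt0 : forall k, (0 < I k)%N)
    (X : tensor R I)
    (m : 'I_N.+1 -> nat) (m_gt0 : forall n, (0 < m n)%N)
    (p : forall k, 'I_(I k) -> R)
    (p_gt0 : forall k i, 0 < p k i)
    (p_sum1 : forall k, \sum_i p k i = 1)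
    (alpha : nat -> R) (alpha_gt0 : forall t, 0 < alpha t)
    (alpha_sum : (\sum_(0 <= t <oo) (alpha t)%:E = +oo)%E)
    (alpha_sum2 : (\sum_(0 <= t <oo) (alpha t ^+ 2)%:E < +oo)%E)
    (Y0 : cores R I rk)
    (d : measure_display) (T : measurableType d) (P : probability T R)
    (e : nat -> T -> draw I m)
    (e_sampling : sampling I_gt0 p P e) :
  let Y t w := iterate I_gt0 p X alpha Y0 (fun s => e s w) t in
  (exists C : R, {ae P, forall w, forall t n,
     Num.sqrt (sqfrob (unfold2 (Y t w n))) <= C}) ->
  limn_einf (fun t => ('E_P[fun w => sqnorm_gradient X (Y t w)])%E) = 0%E.
Proof.
move=> Y [C bounded_Y].
have bounded_iterate :=
  ae_iterate p_gt0 e_sampling (D := bounded_cores C) bounded_Y.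
have [B leB] := curvature_bound rk I_gt0 X m p C.
have sqnorm_ge0 (Z : cores R I rk) : 0 <= sqnorm_gradient X Z.
  by apply: sumr_ge0 => n _; exact: sqfrob_ge0.
under eq_fun => t do
  rewrite (expectation_iterate X p_gt0 alpha Y0 e_sampling) //.
(* The sample point [w0] only provides some history; at time 0 every history gives [Y0]. *)
have [w0 _] := probability_inhabited P.
have sum2_ge0 t : (0 <= (alpha t ^+ 2)%:E)%E by rewrite lee_fin sqr_ge0.
(* The factor [N.+1] undoes the uniform choice of the mode. Taking [|B|] makes the coefficient
   nonnegative, so that the partial sums of squared steps can be replaced by the full series. *)
apply: (@limn_einf_eq0 _ alpha _ (N.+1%:R * (objective X Y0 +
    `|B| * fine (\sum_(0 <= t <oo) (alpha t ^+ 2)%:E)%E))) => // [t|k].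
  exact: mean_ge0.
have leB' (h : nat -> draw I m) t (c : draw I m) :
    curvature I_gt0 X p (iterate I_gt0 p X alpha Y0 h t) c <= `|B|.
  by apply: (le_trans _ (ler_norm B)); apply: leB; exact: bounded_iterate.
have := sum_mean_gradient_le m_gt0 p_gt0 p_sum1 k 0 (fun s => e s w0) leB'.
move=> le_sum; rewrite -ler_pdivrMl ?ltr0n // mulr_sumr.
apply: le_trans (le_trans le_sum _).
  by apply: ler_sum => s _; rewrite add0n mulrA [_^-1 * _]mulrC.
rewrite lerD2l ler_wpM2l // -lee_fin fineK; last first.
  by rewrite ge0_fin_numE // nneseries_ge0.
by rewrite -sumEFin; exact: nneseries_lim_ge.
Qed.
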